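(* Let $\mu$ be a probability measure supported in a bounded interval of $\mathbb{R}$, and let $$u(t,x) \,=\, \frac{\int z\,e^{-zx/2 + z^2t/4} \,d\mu(z)}{\int e^{-zx/2 + z^2t/4} \,d\mu(z)}\,, \qquad t \in \mathbb{R}\,, \quad x \in \mathbb{R}\,.$$ Assume that $0 \notin \mathrm{supp}(\mu)$, and define $a \in [-\infty,0)$ and $b \in (0,+\infty]$ by $$a := \sup\{c < 0\,;\, c \in \mathrm{supp}(\mu)\}\,, \qquad b := \inf\{c > 0\,;\, c \in \mathrm{supp}(\mu)\}\,.$$ (i) If $a+b \neq 0$, then $$\sup_{|x| \le L(t)} \bigl|u(t,x) - d\bigr| \longrightarrow 0 \quad\text{as } t\to-\infty$$ for any function $L:\mathbb{R}_-\to\mathbb{R}_+$ such that $L(t)/|t|\to0$ as $t\to-\infty$, where $d = b$ if $a+b < 0$ and $d = a$ if $a+b > 0$. (ii) If $a+b = 0$, there exists a shift function $s : \mathbb{R} \to \mathbb{R}$ such that $s(t)/t \to 0$ as $t \to -\infty$ and $$\sup_{|x| \le L(t)} \bigl|u(t,x) - \phi_{b,a}(x-s(t))\bigr| \longrightarrow 0 \quad\text{as } t\to-\infty$$ for any function $L:\mathbb{R}_-\to\mathbb{R}_+$ such that $L(t)/|t|\to0$ as $t\to-\infty$, where $\phi_{b,a}(y) = -b\tanh(by/2)$ denotes the viscous shock connecting the constant states $b$ and $a=-b$.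
   Context: The function $u$ is a bounded entire solution of Burgers' equation $\partial_t u+u\,\partial_x u=\partial_x^2 u$. Conventions: $\sup\emptyset=-\infty$ and $\inf\emptyset=+\infty$; $a$ and $b$ cannot be infinite simultaneously, so $a+b\in[-\infty,+\infty]$ is well defined. *)

(* Defs.v *)
From mathcomp Require Import all_boot all_order all_algebra.
From mathcomp Require Import all_classical all_reals all_analysis.
Set Implicit Arguments.
Unset Strict Implicit.
Unset Printing Implicit Defensive.
Import Order.TTheory GRing.Theory Num.Theory.
Import numFieldNormedType.Exports.
Local Open Scope classical_set_scope.
Local Open Scope ring_scope.

(* [measurableTypeR R] is [R] with its Borel sigma-algebra. *)
Definition supp (R : realType) (mu : probability (measurableTypeR R) R)
  : set R :=
  [set x | forall U : set R, open_nbhs x U -> (0 < mu U)%E].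

Definition burgers_entire (R : realType)
    (mu : probability (measurableTypeR R) R) (t x : R) : R :=
  (\int[mu]_(z in [set: R]) (z * expR (- (z * x) / 2 + z ^+ 2 * t / 4))) /
  (\int[mu]_(z in [set: R]) expR (- (z * x) / 2 + z ^+ 2 * t / 4)).

(* In \bar R, so that the supremum of the empty set is -oo and the infimum
   of the empty set is +oo. *)
Definition supp_neg_sup (R : realType)
    (mu : probability (measurableTypeR R) R) : \bar R :=
  ereal_sup [set c%:E | c in [set c : R | c < 0 /\ supp mu c]].

Definition supp_pos_inf (R : realType)
    (mu : probability (measurableTypeR R) R) : \bar R :=
  ereal_inf [set c%:E | c in [set c : R | 0 < c /\ supp mu c]].

Definition tanh (R : realType) (y : R) : R :=
  (expR y - expR (- y)) / (expR y + expR (- y)).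

(* The viscous shock phi_{b,-b}, connecting b (at -oo) to -b (at +oo). *)
Definition viscous_shock (R : realType) (b y : R) : R :=
  - b * tanh (b * y / 2).

(* An extended-real supremum, so that an unbounded f is not assigned a junk
   finite value. *)
Definition sup_dist (R : realType) (r : R) (f g : R -> R) : \bar R :=
  ereal_sup [set `|f x - g x|%:E | x in [set x : R | `|x| <= r]].

(* L : R_- -> R_+ is represented by a total function whose values outside R_-
   are irrelevant. *)
Definition sublinear_at_Ny (R : realType) (L : R -> R) : Prop :=
  (forall t : R, t < 0 -> 0 <= L t) /\
  L t / `|t| @[t --> -oo] --> (0 : R).

(* Main.v *)
Require Import Defs.
From mathcomp Require Import all_boot all_order all_algebra.
From mathcomp Require Import all_classical all_reals all_analysis.
From mathcomp Require Import measurable_realfun ring lra.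
Import Order.TTheory GRing.Theory Num.Theory.
Import numFieldNormedType.Exports.
Local Open Scope classical_set_scope.
Local Open Scope ring_scope.

(** The solution is the barycentre of [mu] for the weight
    exp (- z x / 2 + z^2 t / 4). When t tends to -oo and x = o(|t|), the
    quadratic term dominates and favours small |z| exponentially (Laplace's
    method): all but a fraction o(1) of the weighted mass sits on those z whose
    modulus exceeds the least modulus of the support by less than any prescribed
    amount ([concentration]). If this least modulus is reached on one side of
    the origin only, say near d, the barycentre therefore converges to d
    ([first_moment], [burgers_cvg_bottom]). This is the case a + b <> 0.

    If a = - b, split the support into its positive part P and its negative
    part N, with weighted masses p (t, x) and n (t, x). Concentration on each
    side gives u ~ b (p - n) / (p + n), and

      b (E - 1) / (E + 1) = viscous_shock b y   for E = exp (- b y),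

    so the claim is that p / n is close to exp (- b (x - s)) for a suitable s.
    The shift s (t) is the position where the two masses agree ([balance]); it
    exists and is unique because p / n is continuous and strictly decreasing
    in x. It is o(|t|) because p and n at x = 0 are both exp (b^2 t / 4 + o(t))
    ([balance_sublinear]).

    A displacement of x by h multiplies the weight at z by exp (- z h / 2).
    Every point of P is at least b, and up to a proportion eps of the mass at
    most b + eta; likewise for - N. Hence for h >= 0 the ratio p / n at s + h
    lies between (1 - eps)^2 exp (- (b + eta) h) and exp (- b h)
    ([ratio_upper], [ratio_lower]), and symmetrically for h <= 0 with P and N
    exchanged. The discrepancy of rates eta acts over the unbounded distance h,
    but eta h exp (- b h) <= eta / b, so that the profiles are uniformly close
    ([ratio_profile]). Comparing masses at two positions in this way avoids
    differentiating under the integral sign. *)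

(** * The support carries the whole mass *)

Section support.
Context {R : realType} (mu : probability (measurableTypeR R) R).

Lemma open_not_supp : open (~` supp mu).
Proof.
rewrite openE => p /existsNP[U /not_implyP[[oU Up] muU]].
by rewrite /interior nbhsE; exists U => // q Uq suppq; apply/muU/suppq.
Qed.

Lemma measurable_supp : measurable (supp mu : set (measurableTypeR R)).
Proof.
rewrite -[supp mu]setCK; apply: measurableC.
by apply: open_measurable; exact: open_not_supp.
Qed.

(** Every point off the support has a null neighbourhood, which contains a null
    interval with rational endpoints around the point; there are countably many
    of these. *)
Lemma measure_not_supp : mu (~` supp mu) = 0%E.
Proof.
pose null_itv (pq : rat * rat) : set (measurableTypeR R) :=
  let I := `]ratr pq.1, ratr pq.2[%classic in
  if mu I == 0%E then I else set0.
pose F n := if unpickle n is Some pq then null_itv pq else set0.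
have mN : measurable (~` supp mu : set (measurableTypeR R)).
  by apply: measurableC; exact: measurable_supp.
apply: measure_negligible => //.
apply: (@negligibleS _ _ _ mu (\bigcup_n F n)); last first.
  apply: negligible_bigcup => n; rewrite /F /null_itv.
  case: (unpickle n) => [[p q]|]; last exact: negligible_set0.
  case: eqP => [I0|_]; last exact: negligible_set0.
  by apply/negligibleP => //; exact: measurable_itv.
move=> z /existsNP[U /not_implyP[[oU Uz] /negP]].
rewrite -leNgt => muU0.
have : nbhs z U by rewrite nbhsE; exists U.
rewrite -nbhs_ballE => -[e /= e0 zU].
have [p /itvP pz] : exists p : rat, ratr p \in `]z - e, z[.
  by apply: rat_in_itvoo; rewrite ltrBlDr ltrDl.
have [q /itvP qz] : exists q : rat, ratr q \in `]z, z + e[.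
  by apply: rat_in_itvoo; rewrite ltrDl.
exists (pickle (p, q)); first exact: I.
rewrite /F pickleK /null_itv /=.
have sub : `]ratr p, ratr q[ `<=` U.
  move=> y /=; rewrite in_itv /= => /andP[py yq]; apply: zU.
  rewrite /ball /= distrC ltr_distl (lt_trans _ py) ?pz //=.
  by rewrite (lt_trans yq) ?qz.
case: eqP => [_ /=|]; first by rewrite in_itv /= pz qz.
case; apply/eqP; rewrite eq_le measure_ge0 andbT (le_trans _ muU0) //.
apply: le_measure => //; rewrite inE; first exact: measurable_itv.
exact: open_measurable.
Qed.

Lemma measure_suppI (A : set (measurableTypeR R)) : measurable A ->
  mu (supp mu `&` A) = mu A.
Proof.
move=> mA; have mS := measurable_supp.
rewrite -[in RHS](setUIDK A (supp mu)) setIC measureU0 //.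
- exact: measurableI.
- exact: measurableD.
- apply: (subset_measure0 _ _ _ measure_not_supp) => [||z []//].
    exact: measurableD.
  exact: measurableC.
Qed.

End support.

(** * Masses for the exponential weight *)

Lemma fine_measure_gt0 {R : realType} (mu : probability (measurableTypeR R) R)
  (A : set (measurableTypeR R)) :
  measurable A -> (0 < mu A)%E -> 0 < fine (mu A).
Proof.
move=> mA A_gt0; rewrite fine_gt0 // A_gt0 /=.
by rewrite (le_lt_trans (probability_le1 mu mA)) ?ltry.
Qed.

Definition weight {R : realType} (t x z : R) : R :=
  expR (- (z * x) / 2 + z ^+ 2 * t / 4).

Definition centered {R : realType} (c : R) : set (measurableTypeR R) :=
  [set z | `|z| <= c].
Arguments centered {R} c%_R.

Definition mass {R : realType} (mu : probability (measurableTypeR R) R)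
  (D : set R) (t x : R) : R := \int[mu]_(z in D) weight t x z.

Section mass.
Context {R : realType} (mu : probability (measurableTypeR R) R) (C : R).
Implicit Types (D A : set (measurableTypeR R)) (t x y z : R).

Lemma continuous_weight t x : continuous (weight t x).
Proof.
move=> z; apply: continuous_comp; last exact: continuous_expR.
apply: cvgD; apply: cvgMr_tmp.
  by apply: cvgN; apply: cvgMr_tmp; exact: cvg_id.
by apply: cvgMr_tmp; exact: exprn_continuous.
Qed.

Lemma integrable_continuous D (f : R -> R) : measurable D ->
  D `<=` centered C -> continuous f -> mu.-integrable D (EFin \o f).
Proof.
move=> mD DC cf; apply: measurable_bounded_integrable => //.
- by rewrite (le_lt_trans (probability_le1 mu mD)) ?ltry.
- apply: measurable_funTS; exact: continuous_measurable_fun.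
have : bounded_set (f @` `[- C, C]).
  apply/compact_bounded/continuous_compact; last exact: segment_compact.
  exact: continuous_subspaceT.
move=> [M [Mr fM]]; exists M; split => // K MK z Dz; apply: (fM K MK).
by exists z => //=; rewrite in_itv /= -ler_norml; exact: DC.
Qed.

Lemma integrable_weight D t x : measurable D -> D `<=` centered C ->
  mu.-integrable D (EFin \o weight t x).
Proof.
by move=> mD DC; apply: integrable_continuous => //; exact: continuous_weight.
Qed.

Lemma integrable_mul_weight D (f : R -> R) t x :
  measurable D -> D `<=` centered C -> continuous f ->
  mu.-integrable D (EFin \o (fun z => f z * weight t x z)).
Proof.
move=> mD DC cf; apply: integrable_continuous => // z.
by apply: cvgM; [exact: cf|exact: continuous_weight].
Qed.

Lemma mass_ge0 D t x : 0 <= mass mu D t x.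
Proof. by apply: Rintegral_ge0 => z _; exact: expR_ge0. Qed.

(** A displacement y of the position multiplies the weight at z by
    exp (- z y / 2). Applied from x + y with displacement - y, the same
    inequality gives lower bounds. *)
Lemma mass_shift D k t x y : measurable D -> D `<=` centered C ->
  (forall z, D z -> - (z * y) / 2 <= k) ->
  mass mu D t (x + y) <= expR k * mass mu D t x.
Proof.
move=> mD DC Dk; rewrite /mass -RintegralZl //; last exact: integrable_weight.
apply: le_Rintegral => //; first exact: integrable_weight.
  by apply: integrable_mul_weight => // z; exact: cvg_cst.
move=> z Dz; rewrite /weight -expRD ler_expR.
by have := Dk z Dz; lra.
Qed.

Lemma mass_ge D c t x : measurable D -> t <= 0 -> 0 <= c ->
  D `<=` centered C -> D `<=` centered c ->
  fine (mu D) * expR (- (c * `|x|) / 2 + c ^+ 2 * t / 4) <= mass mu D t x.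
Proof.
move=> mD t0 c0 DC Dc.
rewrite mulrC -Rintegral_cst //; apply: le_Rintegral => //.
- by apply: integrable_continuous => // z; exact: cvg_cst.
- exact: integrable_weight.
move=> z /Dc /= zc; rewrite ler_expR.
have zx : z * x <= c * `|x|.
  by rewrite (le_trans (ler_norm _)) // normrM ler_wpM2r.
have z2 : z ^+ 2 <= c ^+ 2.
  by rewrite -[z ^+ 2]real_normK ?num_real // ler_sqr.
nra.
Qed.

Lemma mass_le D c t x : measurable D -> t <= 0 -> 0 <= c -> 0 <= C ->
  D `<=` [set z | c <= `|z|] -> D `<=` centered C ->
  mass mu D t x <= expR (C * `|x| / 2 + c ^+ 2 * t / 4).
Proof.
move=> mD t0 c0 C0 Dc DC.
set k := expR _; have : mass mu D t x <= k * fine (mu D).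
  rewrite -Rintegral_cst //; apply: le_Rintegral => //.
  - exact: integrable_weight.
  - by apply: integrable_continuous => // z; exact: cvg_cst.
  move=> z Dz; rewrite ler_expR.
  have /= zc := Dc z Dz; have /= zC := DC z Dz.
  have zx : - (z * x) <= C * `|x|.
    by rewrite (le_trans (ler_norm _)) // normrN normrM ler_wpM2r.
  have z2 : c ^+ 2 <= z ^+ 2.
    by rewrite -[z ^+ 2]real_normK ?num_real // ler_sqr.
  nra.
move/le_trans; apply; rewrite ger_pMr ?expR_gt0 //.
rewrite -lee_fin fineK; first exact: probability_le1.
exact: fin_num_measure.
Qed.

Lemma mass_split D A t x : measurable D -> measurable A ->
  D `<=` centered C ->
  mass mu D t x = mass mu (D `&` A) t x + mass mu (D `\` A) t x.
Proof.
move=> mD mA DC; rewrite /mass -{1}(setUIDK D A) Rintegral_setU //.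
- exact: measurableI.
- exact: measurableD.
- by rewrite setUIDK; exact: integrable_weight.
- by apply/disj_setPS => z [[_ Az] [_]].
Qed.

End mass.

(** * Uniformity in sublinear ranges of x *)

(** The cone |x| <= delta |t| eventually contains every range |x| <= L t with L
    sublinear, so an estimate on such a cone is uniform over all of these ranges
    at once, whatever the rate at which L t / |t| tends to 0. *)
Definition near_cone {R : realType} (P : R -> R -> Prop) : Prop :=
  exists2 delta : R, 0 < delta &
    \forall t \near -oo, forall x, `|x| <= delta * `|t| -> P t x.

Section cone.
Context {R : realType}.
Implicit Types (P Q : R -> R -> Prop) (L : R -> R).

Lemma near_coneI P Q : near_cone P -> near_cone Q ->
  near_cone (fun t x => P t x /\ Q t x).
Proof.
move=> [d1 d1_gt0 H1] [d2 d2_gt0 H2]; exists (Num.min d1 d2).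
  by rewrite lt_min d1_gt0.
apply: filterS2 H1 H2 => t P1 Q2 x xt; split.
- by apply: P1; rewrite (le_trans xt) // ler_wpM2r // ge_min lexx.
- by apply: Q2; rewrite (le_trans xt) // ler_wpM2r // ge_min lexx orbT.
Qed.

Lemma near_coneS P Q : (\forall t \near -oo, forall x, P t x -> Q t x) ->
  near_cone P -> near_cone Q.
Proof.
move=> PQ [d d_gt0 H]; exists d => //.
by apply: filterS2 PQ H => t PQt Pt x /Pt /PQt.
Qed.

Lemma near_cone_sublinear P L : sublinear_at_Ny L -> near_cone P ->
  \forall t \near -oo, forall x, `|x| <= L t -> P t x.
Proof.
move=> [L0 /cvgrPdist_le Lt] [d d_gt0 H].
near=> t; move=> x xL; have t0 : t < 0 by near: t; exact: nbhs_ninfty_lt.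
have Pt : forall x, `|x| <= d * `|t| -> P t x by near: t.
apply: Pt; apply: (le_trans xL).
have : `|0 - L t / `|t| | <= d by near: t; apply: Lt.
rewrite sub0r normrN ger0_norm ?divr_ge0 ?L0 // ler_pdivrMr //.
by rewrite normr_gt0 lt_eqF.
Unshelve. all: by end_near. Qed.

Lemma sup_dist_cvg0 L (f g : R -> R -> R) : sublinear_at_Ny L ->
  (forall eps, 0 < eps -> near_cone (fun t x => `|f t x - g t x| <= eps)) ->
  sup_dist (L t) (f t) (g t) @[t --> -oo] --> (0%E : \bar R).
Proof.
move=> HL Hfg.
have sup_le eps : 0 < eps ->
    \forall t \near -oo, (0 <= sup_dist (L t) (f t) (g t) <= eps%:E)%E.
  move=> eps_gt0; have := near_cone_sublinear _ _ HL (Hfg _ eps_gt0) => H.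
  near=> t; have t0 : t < 0 by near: t; exact: nbhs_ninfty_lt.
  have Ht : forall x, `|x| <= L t -> `|f t x - g t x| <= eps by near: t.
  apply/andP; split.
    apply: (@le_trans _ _ `|f t 0 - g t 0|%:E); first by rewrite lee_fin.
    apply: ereal_sup_ubound; exists 0 => //=.
    by rewrite normr0; case: HL => + _; exact.
  by apply: ge_ereal_sup => _ [x /= xL <-]; rewrite lee_fin; exact: Ht.
apply/fine_cvgP; split.
  near=> t; have /andP[s0 s1] :
    (0 <= sup_dist (L t) (f t) (g t) <= 1%:E)%E by near: t; exact: sup_le.
  by rewrite ge0_fin_numE // (le_lt_trans s1) ?ltry.
apply/cvgrPdist_le => eps eps_gt0.
apply: filterS (sup_le _ eps_gt0) => t /andP[s0 s1] /=.
have sfin : sup_dist (L t) (f t) (g t) \is a fin_num.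
  by rewrite ge0_fin_numE // (le_lt_trans s1) ?ltry.
rewrite sub0r normrN ger0_norm ?fine_ge0 //.
by rewrite -lee_fin fineK.
Unshelve. all: by end_near. Qed.

End cone.

(** * Laplace concentration at the points of least modulus *)

Section concentration.
Context {R : realType} (mu : probability (measurableTypeR R) R) (C : R).
Implicit Types (D A : set (measurableTypeR R)) (t x y z : R).

Lemma measurable_centered (c : R) : measurable (centered c).
Proof.
rewrite (_ : centered c = `[- c, c]%classic); first exact: measurable_itv.
by apply/seteqP; split => z; rewrite /centered /= in_itv /= ler_norml.
Qed.

Lemma mass_ge_near D c t x : measurable D -> t <= 0 -> 0 <= c ->
  D `<=` centered C ->
  fine (mu (D `&` centered c)) *
    expR (- (c * `|x|) / 2 + c ^+ 2 * t / 4) <= mass mu D t x.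
Proof.
move=> mD t0 c0 DC; have mc := measurable_centered c.
rewrite (mass_split mu C D _ t x mD mc DC).
apply: le_trans (_ : mass mu (D `&` centered c) t x <= _); last first.
  by rewrite lerDl mass_ge0.
apply: (mass_ge mu C) => //; first exact: measurableI.
by move=> z [/DC].
Qed.

(** Where the modulus exceeds beta + eta, the weight is at most
    exp (C |x| / 2 + (beta + eta)^2 t / 4), whereas the part of D of modulus at
    most beta + eta / 2 alone contributes a fixed positive multiple of
    exp (- (beta + eta / 2) |x| / 2 + (beta + eta / 2)^2 t / 4). The gap between
    the quadratic terms absorbs the terms in |x| when |x| is a small multiple
    of |t|. *)
Lemma concentration D (beta eta eps : R) : measurable D ->
  D `<=` centered C -> 0 <= C -> 0 <= beta -> 0 < eta -> 0 < eps ->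
  (forall e : R, 0 < e -> (0 < mu (D `&` centered (beta + e)))%E) ->
  near_cone (fun t x => mass mu (D `\` centered (beta + eta)) t x <=
                        eps * mass mu D t x).
Proof.
move=> mD DC C0 beta0 eta0 eps0 near_gt0.
set K := C + beta + eta; have K_gt0 : 0 < K by rewrite /K; lra.
set m := fine (mu (D `&` centered (beta + eta / 2))).
have m_gt0 : 0 < m.
  apply: fine_measure_gt0; last by rewrite near_gt0 ?divr_gt0.
  by apply: measurableI => //; exact: measurable_centered.
(* The gap (beta + eta)^2 - (beta + eta / 2)^2 is at least 3/4 eta^2. With this
   slope of the cone the terms in |x| cost at most eta^2 |t| / 16, which leaves
   at least eta^2 |t| / 8 of the available 3/16 eta^2 |t|. *)
exists (eta ^+ 2 / (8 * K)); first by rewrite divr_gt0 ?exprn_gt0 ?mulr_gt0.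
near=> t; have t_lt0 : t < 0 by near: t; exact: nbhs_ninfty_lt.
have tT : t <= ln (eps * m) * 16 / eta ^+ 2.
  by near: t; apply: nbhs_ninfty_le; exact: num_real.
have tm : expR (eta ^+ 2 * t / 16) <= eps * m.
  rewrite -[leRHS]lnK ?posrE ?mulr_gt0 // ler_expR ler_pdivrMr //.
  by rewrite mulrC -ler_pdivlMr ?exprn_gt0.
move=> x; rewrite (ltr0_norm t_lt0) => xt.
apply: (le_trans (mass_le mu C _ (beta + eta) t x _ (ltW t_lt0) _ C0 _ _)).
- by apply: measurableD => //; exact: measurable_centered.
- by rewrite addr_ge0 // ltW.
- by move=> z [_ /= /negP]; rewrite -ltNge => /ltW.
- by move=> z [/DC].
have e2 : 0 <= beta + eta / 2 by lra.
have := mass_ge_near D (beta + eta / 2) t x mD (ltW t_lt0) e2 DC.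
rewrite -/m -(ler_pM2l eps0); apply: le_trans; rewrite mulrA.
apply: le_trans (ler_wpM2r (expR_ge0 _) tm).
rewrite -expRD ler_expR.
have Kx : K * `|x| <= eta ^+ 2 * - t / 8.
  rewrite -ler_pdivlMl //; apply: (le_trans xt).
  by rewrite le_eqVlt; apply/orP; left; apply/eqP; field; rewrite gt_eqF.
have : 0 <= `|x| by [].
move: Kx; rewrite /K => Kx x0.
have : 0 <= beta * eta * - t by rewrite !mulr_ge0 // ?oppr_ge0 ltW.
have : 0 <= eta ^+ 2 * - t by rewrite mulr_ge0 ?sqr_ge0 // oppr_ge0 ltW.
have : 0 <= eta * `|x| by rewrite mulr_ge0 // ltW.
lra.
Unshelve. all: by end_near. Qed.

(** D has mass near d, d has the least modulus among the points of D, and the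
    points of D whose modulus is close to |d| lie on the same side of the origin
    as d. The last two conditions are expressed together by saying that, for
    those points, the distance to d is the excess of modulus. *)
Definition bottom_point D (d : R) :=
  (forall e : R, 0 < e -> (0 < mu (D `&` centered (`|d| + e)))%E) /\
  exists2 eta : R, 0 < eta &
    forall z, D z -> `|z| <= `|d| + eta -> `|z - d| = `|z| - `|d|.

(** The points of D whose modulus is within eta of |d| are within eta of d, and
    the others carry a negligible share of the mass while |z - d| stays bounded
    by C + |d|. *)
Lemma first_moment D (d eps : R) : measurable D -> D `<=` centered C ->
  0 <= C -> bottom_point D d -> 0 < eps ->
  near_cone (fun t x => `|\int[mu]_(z in D) (z * weight t x z) -
                         d * mass mu D t x| <= eps * mass mu D t x).
Proof.
move=> mD DC C0 [near_gt0 [eta0 eta0_gt0 Dd]] eps_gt0.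
set eta := Num.min eta0 (eps / 2).
have eta_gt0 : 0 < eta by rewrite lt_min eta0_gt0 divr_gt0.
set K := C + `|d|; have K0 : 0 <= K by rewrite addr_ge0.
have eps'_gt0 : 0 < eps / (2 * (K + 1)).
  by rewrite divr_gt0 // mulr_gt0 // ltr_pwDr.
have far := concentration D `|d| eta _ mD DC C0 (normr_ge0 d) eta_gt0 eps'_gt0
  near_gt0.
apply: near_coneS far.
near=> t => x far_le.
set A := centered (`|d| + eta) in far_le *.
have mA : measurable A by exact: measurable_centered.
have mDA : measurable (D `&` A) by exact: measurableI.
have mDnA : measurable (D `\` A) by exact: measurableD.
have DAC : D `&` A `<=` centered C by move=> z [/DC].
have DnAC : D `\` A `<=` centered C by move=> z [/DC].
have cid : continuous (id : R -> R) by move=> z; exact: cvg_id.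
have ccst (k : R) : continuous (fun _ : R => k) by exact: cst_continuous.
have cd : continuous (fun z : R => z - d).
  by move=> z; apply: cvgB; [exact: cvg_id|exact: cvg_cst].
have cnd : continuous (fun z : R => `|z - d|).
  by move=> z; apply: cvg_norm; exact: cd.
rewrite /mass -RintegralZl //; last exact: (integrable_weight mu C).
rewrite -RintegralB //; last 2 first.
- exact: (integrable_mul_weight mu C).
- exact: (integrable_mul_weight mu C).
under eq_Rintegral do rewrite -mulrBl.
have int_d := integrable_mul_weight mu C D _ t x mD DC cd.
apply: (le_trans (le_normr_Rintegral mD int_d)).
under eq_Rintegral do rewrite normrM [X in _ * X]ger0_norm ?expR_ge0 //.
rewrite -/(mass mu D t x) -{1}(setUIDK D A) Rintegral_setU //; last 2 first.
- by rewrite setUIDK; exact: (integrable_mul_weight mu C).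
- by apply/disj_setPS => z [[_ Az] [_]].
have near_part : \int[mu]_(z in D `&` A) (`|z - d| * weight t x z) <=
    eps / 2 * mass mu (D `&` A) t x.
  rewrite /mass -RintegralZl //; last exact: (integrable_weight mu C).
  apply: le_Rintegral => //; try exact: (integrable_mul_weight mu C).
  move=> z [Dz zA]; have zd : `|z| <= `|d| + eta by exact: zA.
  rewrite ler_wpM2r ?expR_ge0 //.
  rewrite Dd //; last by rewrite (le_trans zd) // lerD2l ge_min lexx.
  have : eta <= eps / 2 by rewrite ge_min lexx orbT.
  by lra.
have far_part : \int[mu]_(z in D `\` A) (`|z - d| * weight t x z) <=
    K * mass mu (D `\` A) t x.
  rewrite /mass -RintegralZl //; last exact: (integrable_weight mu C).
  apply: le_Rintegral => //; try exact: (integrable_mul_weight mu C).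
  move=> z Dz; rewrite ler_wpM2r ?expR_ge0 //.
  by rewrite (le_trans (ler_normB _ _)) // lerD2r; exact: DnAC.
apply: (le_trans (lerD near_part far_part)).
have split := mass_split mu C D A t x mD mA DC.
have n0 := mass_ge0 mu (D `&` A) t x; have f0 := mass_ge0 mu (D `\` A) t x.
have : (K + 1) * mass mu (D `\` A) t x <= eps / 2 * mass mu D t x.
  rewrite -ler_pdivlMl ?ltr_pwDr //; apply: (le_trans far_le).
  rewrite le_eqVlt; apply/orP; left; apply/eqP; field.
  by rewrite gt_eqF // ltr_pwDr.
have : eps / 2 * mass mu (D `&` A) t x <= eps / 2 * mass mu D t x.
  by rewrite ler_pM2l ?divr_gt0 // split lerDl.
lra.
Unshelve. all: by end_near. Qed.

End concentration.

(** * The shock as a function of the ratio of two masses *)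

Section profile.
Context {R : realType}.
Implicit Types (b y p n eps eta : R).

Lemma viscous_shockE b y :
  viscous_shock b y = b * ((expR (- (b * y)) - 1) / (expR (- (b * y)) + 1)).
Proof.
rewrite /viscous_shock /tanh.
rewrite (_ : - (b * y) = - (b * y / 2) + - (b * y / 2)); last by lra.
rewrite expRD expRN; have := expR_gt0 (b * y / 2).
set e := expR _ => e_gt0; have e2 : 0 < 1 + e ^+ 2 by rewrite ltr_pwDl ?sqr_ge0.
field; rewrite !gt_eqF //=; nra.
Qed.

Lemma viscous_shockN b y : viscous_shock b (- y) = - viscous_shock b y.
Proof.
have tanhN u : tanh (- u) = - tanh u.
  by rewrite /tanh opprK -mulNr opprB [expR u + _]addrC.
by rewrite /viscous_shock mulrN [- _ / 2]mulNr tanhN mulrN.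
Qed.

Lemma mul_expRN_le1 y : 0 <= y -> y * expR (- y) <= 1.
Proof.
move=> y0; rewrite expRN ler_pdivrMr ?expR_gt0 // mul1r.
by rewrite (le_trans _ (expR_ge1Dx y)) // lerDr.
Qed.

(** The map r |-> (r - 1) / (r + 1) is 2-Lipschitz on the positive reals, and
    (p - n) / (p + n) is its value at p / n. *)
Lemma mobius_lipschitz p n E : 0 < p -> 0 < n -> 0 < E ->
  `|(p - n) / (p + n) - (E - 1) / (E + 1)| <= 2 * `|p / n - E|.
Proof.
move=> p0 n0 E0; have r0 : 0 < p / n by rewrite divr_gt0.
have -> : (p - n) / (p + n) - (E - 1) / (E + 1) =
    (p / n - E) * (2 / ((p / n + 1) * (E + 1))).
  by field; rewrite !gt_eqF //= ?addr_gt0 ?mulr_gt0.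
rewrite normrM mulrC ler_wpM2r // ger0_norm; last first.
  by rewrite divr_ge0 // mulr_ge0 // addr_ge0 // ltW.
rewrite ler_pdivrMr; last by rewrite mulr_gt0 // addr_gt0.
nra.
Qed.

(** A mismatch of rates eta over the distance y changes the ratio by at most
    eta y exp (- b y) <= eta / b, uniformly in y >= 0. *)
Lemma ratio_profile b eta eps y p n : 0 < b -> 0 <= eta -> 0 <= eps ->
  eps <= 1 -> 0 <= y -> 0 < p -> 0 < n -> p <= expR (- (b * y)) * n ->
  (1 - eps) ^+ 2 * expR (- ((b + eta) * y)) * n <= p ->
  `|b * ((p - n) / (p + n)) - viscous_shock b y| <= b * (4 * eps + 2 * eta / b).
Proof.
move=> b0 eta0 eps0 eps1 y0 p0 n0 p_le p_ge.
rewrite viscous_shockE -mulrBr normrM gtr0_norm // ler_pM2l //.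
apply: (le_trans (mobius_lipschitz _ _ _ p0 n0 (expR_gt0 _))).
set E := expR (- (b * y)) in p_le *; have E0 : 0 < E by exact: expR_gt0.
rewrite distrC ger0_norm; last by rewrite subr_ge0 ler_pdivrMr.
have r_ge : (1 - eps) ^+ 2 * expR (- ((b + eta) * y)) <= p / n.
  by rewrite ler_pdivlMr.
have eE : expR (- ((b + eta) * y)) = E * expR (- (eta * y)).
  by rewrite -expRD; congr expR; ring.
have e1 : 1 - eta * y <= expR (- (eta * y)) by exact: expR_ge1Dx.
have E1 : E <= 1 by rewrite -[leRHS]expR0 ler_expR oppr_le0 mulr_ge0 // ltW.
have byE : b * y * E <= 1 by apply: mul_expRN_le1; rewrite mulr_ge0 // ltW.
have yE : y * E <= b^-1 by rewrite -(ler_pM2l b0) mulfV ?gt_eqF // mulrA.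
rewrite eE in r_ge; set q := p / n in r_ge *.
have sq : 1 - 2 * eps <= (1 - eps) ^+ 2 by nra.
have sq1 : (1 - eps) ^+ 2 <= 1 by nra.
have sq0 : 0 <= (1 - eps) ^+ 2 by exact: sqr_ge0.
have h1 : (1 - eps) ^+ 2 * (E * (1 - eta * y)) <= q.
  by apply: le_trans r_ge; rewrite ler_wpM2l // ler_pM2l.
have h2 : eta * (y * E) <= eta * b^-1 by rewrite ler_wpM2l.
have yE0 : 0 <= eta * (y * E) by rewrite !mulr_ge0 // ltW.
have h3 : (1 - eps) ^+ 2 * (eta * (y * E)) <= eta * (y * E) by rewrite ler_piMl.
have h4 : (1 - 2 * eps) * E <= (1 - eps) ^+ 2 * E by rewrite ler_pM2r.
have h5 : eps * E <= eps by rewrite ler_piMr.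
lra.
Qed.

End profile.

(** * Comparison of masses at different positions *)

Section mass_comparison.
Context {R : realType} (mu : probability (measurableTypeR R) R) (C : R).
Implicit Types (D A B : set (measurableTypeR R)) (t x b h : R).

Lemma mass_gt0 D (beta t x : R) : measurable D -> D `<=` centered C ->
  0 <= beta -> (0 < mu (D `&` centered beta))%E -> t <= 0 -> 0 < mass mu D t x.
Proof.
move=> mD DC beta0 mu_gt0 t0.
apply: lt_le_trans (mass_ge_near mu C D beta t x mD t0 beta0 DC).
rewrite mulr_gt0 ?expR_gt0 // fine_measure_gt0 //.
by apply: measurableI => //; exact: measurable_centered.
Qed.

(** By [mass_shift], the logarithm of the mass is Lipschitz in x with constant
    C / 2. *)
Lemma continuous_mass D t : measurable D -> D `<=` centered C ->
  continuous (mass mu D t).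
Proof.
move=> mD DC x.
have lip u v : mass mu D t v <= expR (C * `|v - u| / 2) * mass mu D t u.
  have /= := mass_shift mu C D (C * `|v - u| / 2) t u (v - u) mD DC.
  rewrite [u + _]addrC subrK; apply => z /DC zC.
  rewrite ler_pM2r // (le_trans (ler_norm _)) // normrN normrM.
  exact: ler_wpM2r zC.
pose k v := expR (C * `|v - x| / 2).
have ck : k v @[v --> x] --> (1 : R).
  rewrite (_ : (1 : R) = k x); last first.
    by rewrite /k subrr normr0 mulr0 mul0r expR0.
  rewrite /k; apply: continuous_cvg; first exact: continuous_expR.
  apply: cvgMr_tmp; apply: cvgMl_tmp; apply: cvg_norm.
  by apply: cvgB; [exact: cvg_id|exact: cvg_cst].
have sq : \forall v \near x, (k v)^-1 * mass mu D t x <= mass mu D t v <=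
    k v * mass mu D t x.
  near=> v; rewrite lip andbT ler_pdivrMl ?expR_gt0 //.
  by rewrite /k distrC; exact: lip.
apply: (squeeze_cvgr sq).
- have := cvgM (cvgV (oner_neq0 R) ck) (cvg_cst (mass mu D t x)).
  by rewrite invr1 mul1r; exact.
- by have := cvgM ck (cvg_cst (mass mu D t x)); rewrite mul1r; exact.
Unshelve. all: by end_near. Qed.

Lemma mass_decay D b t x h : measurable D -> D `<=` centered C ->
  (forall z, D z -> b * `|h| <= z * h) ->
  mass mu D t (x + h) <= expR (- (b * `|h|) / 2) * mass mu D t x.
Proof.
move=> mD DC Dh; apply: (mass_shift mu C) => // z /Dh.
by rewrite ler_pM2r // lerN2.
Qed.

(** Only the bulk of the mass at x, which sits on the points of modulus at most
    c, is transported to x + h: it loses at most the factor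
    exp (- c |h| / 2). *)
Lemma mass_shift_ge D (eps c t x h : R) : measurable D -> D `<=` centered C ->
  0 <= c -> mass mu (D `\` centered c) t x <= eps * mass mu D t x ->
  (1 - eps) * expR (- (c * `|h|) / 2) * mass mu D t x <= mass mu D t (x + h).
Proof.
move=> mD DC c0 far.
have mc := measurable_centered c.
have mDc : measurable (D `&` centered c) by exact: measurableI.
have split y := mass_split mu C D (centered c) t y mD mc DC.
apply: le_trans (_ : mass mu (D `&` centered c) t (x + h) <= _); last first.
  by rewrite split lerDl mass_ge0.
have DcC : D `&` centered c `<=` centered C by move=> z [/DC].
have back : mass mu (D `&` centered c) t x <=
    expR (c * `|h| / 2) * mass mu (D `&` centered c) t (x + h).
  rewrite -{1}(addrK h x); apply: (mass_shift mu C) => // z [_ zc].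
  rewrite ler_pM2r // mulrN opprK (le_trans (ler_norm _)) // normrM.
  exact: ler_wpM2r zc.
rewrite mulrAC mulrC mulNr expRN ler_pdivrMl ?expR_gt0 //.
by apply: le_trans back; move: far (split x); lra.
Qed.

End mass_comparison.

(** * The balance of the two sides of the support *)

Section two_sided.
Context {R : realType} (mu : probability (measurableTypeR R) R) (C b : R).
Context (C_ge0 : 0 <= C) (b_gt0 : 0 < b).
Implicit Types (D A B : set (measurableTypeR R)) (t x h eps : R).

(** Together with [mass_le] this says that the logarithm of the mass at x = 0 is
    beta^2 t / 4 + o(t). *)
Lemma laplace_lower D (beta eps : R) : measurable D -> D `<=` centered C ->
  0 <= beta -> 0 < eps ->
  (forall e : R, 0 < e -> (0 < mu (D `&` centered (beta + e)))%E) ->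
  \forall t \near -oo, expR (beta ^+ 2 * t / 4 + eps * t) <= mass mu D t 0.
Proof.
move=> mD DC beta0 eps_gt0 near_gt0.
(* This makes (beta + eta)^2 <= beta^2 + 2 eps, which costs eps t / 2 in the
   exponent; the other eps t / 2 pays for the factor m below. *)
set eta := Num.min 1 (2 * eps / (2 * beta + 1)).
have b1 : 0 < 2 * beta + 1 by lra.
have eta_gt0 : 0 < eta by rewrite lt_min ltr01 divr_gt0 // mulr_gt0.
have eta_le1 : eta <= 1 by rewrite ge_min lexx.
have eta_le : eta * (2 * beta + 1) <= 2 * eps.
  by rewrite -ler_pdivlMr // ge_min lexx orbT.
set m := fine (mu (D `&` centered (beta + eta))).
have m_gt0 : 0 < m.
  apply: fine_measure_gt0; last exact: near_gt0.
  by apply: measurableI => //; exact: measurable_centered.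
near=> t; have t_lt0 : t < 0 by near: t; exact: nbhs_ninfty_lt.
have tT : t <= ln m * 2 / eps.
  by near: t; apply: nbhs_ninfty_le; exact: num_real.
have c0 : 0 <= beta + eta by rewrite addr_ge0 // ltW.
apply: le_trans (mass_ge_near mu C D (beta + eta) t 0 mD (ltW t_lt0) c0 DC).
rewrite -/m normr0 mulr0 oppr0 mul0r add0r -[m]lnK ?posrE //.
rewrite -expRD ler_expR.
move: tT; rewrite ler_pdivlMr // => tT.
have : eta ^+ 2 <= eta by rewrite expr2 ler_piMl // ltW.
move=> eta2; have sq : (beta + eta) ^+ 2 <= beta ^+ 2 + 2 * eps by lra.
have : (beta ^+ 2 + 2 * eps) * t <= (beta + eta) ^+ 2 * t by rewrite ler_nM2r.
lra.
Unshelve. all: by end_near. Qed.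

(** The two sets are meant to be the sides of the support: the side A on which
    the displacement h decreases the weight, and the opposite side B. The bound
    on the change of the ratio of their masses is stated without divisions. *)
Lemma ratio_upper A B t s h : measurable A -> measurable B ->
  A `<=` centered C -> B `<=` centered C ->
  (forall z, A z -> b * `|h| <= z * h) ->
  (forall z, B z -> b * `|h| <= z * - h) ->
  mass mu A t (s + h) * mass mu B t s <=
  expR (- (b * `|h|)) * (mass mu A t s * mass mu B t (s + h)).
Proof.
move=> mA mB AC BC Ah Bh.
have decA := mass_decay mu C A b t s h mA AC Ah.
have Bh' z : B z -> b * `|- h| <= z * - h by rewrite normrN; exact: Bh.
have := mass_decay mu C B b t (s + h) (- h) mB BC Bh'.
rewrite addrK normrN => decB.
apply: (le_trans (ler_pM (mass_ge0 _ _ _ _) (mass_ge0 _ _ _ _) decA decB)).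
rewrite mulrACA -expRD (_ : _ + _ = - (b * `|h|)) //; lra.
Qed.

Lemma ratio_lower A B (eps c t s h : R) : measurable A -> measurable B ->
  A `<=` centered C -> B `<=` centered C -> 0 <= c -> eps <= 1 ->
  mass mu (A `\` centered c) t s <= eps * mass mu A t s ->
  mass mu (B `\` centered c) t (s + h) <= eps * mass mu B t (s + h) ->
  (1 - eps) ^+ 2 * expR (- (c * `|h|)) * (mass mu A t s * mass mu B t (s + h))
    <= mass mu A t (s + h) * mass mu B t s.
Proof.
move=> mA mB AC BC c0 eps1 farA farB.
have loA := mass_shift_ge mu C A eps c t s h mA AC c0 farA.
have := mass_shift_ge mu C B eps c t (s + h) (- h) mB BC c0 farB.
rewrite addrK normrN => loB.
have k0 : 0 <= (1 - eps) * expR (- (c * `|h|) / 2).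
  by rewrite mulr_ge0 ?expR_ge0 // subr_ge0.
set k := (1 - eps) * _ in k0 loA loB.
have -> : (1 - eps) ^+ 2 * expR (- (c * `|h|)) = k * k.
  by rewrite mulrACA -expRD -expr2; congr (_ * expR _); lra.
by rewrite mulrACA; apply: ler_pM => //; rewrite mulr_ge0 // mass_ge0.
Qed.

(** Stated for |h|, so that it serves on both sides of the balance point: for
    h < 0 the roles of the two sides of the support are exchanged. *)
Lemma balanced_profile A B (eps eta t s h : R) : measurable A -> measurable B ->
  A `<=` centered C -> B `<=` centered C ->
  (forall z, A z -> b * `|h| <= z * h) ->
  (forall z, B z -> b * `|h| <= z * - h) ->
  (forall x, 0 < mass mu A t x) -> (forall x, 0 < mass mu B t x) ->
  mass mu A t s = mass mu B t s -> 0 <= eta -> 0 <= eps -> eps <= 1 ->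
  mass mu (A `\` centered (b + eta)) t s <= eps * mass mu A t s ->
  mass mu (B `\` centered (b + eta)) t (s + h) <= eps * mass mu B t (s + h) ->
  `|b * ((mass mu A t (s + h) - mass mu B t (s + h)) /
         (mass mu A t (s + h) + mass mu B t (s + h))) -
    viscous_shock b `|h| | <= b * (4 * eps + 2 * eta / b).
Proof.
move=> mA mB AC BC Ah Bh A_gt0 B_gt0 bal eta0 eps0 eps1 farA farB.
have up := ratio_upper A B t s h mA mB AC BC Ah Bh.
have c0 : 0 <= b + eta by rewrite addr_ge0 // ltW.
have lo := ratio_lower A B eps _ t s h mA mB AC BC c0 eps1 farA farB.
rewrite bal [_ * mass mu B t s]mulrC [in X in _ <= X](mulrCA (expR _)) in up.
rewrite bal [X in _ <= X]mulrC [X in X <= _](mulrCA (_ * expR _)) in lo.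
rewrite ler_pM2l // in up; rewrite ler_pM2l // in lo.
exact: ratio_profile.
Qed.

Context (P N : set (measurableTypeR R)).
Context (mP : measurable P) (mN : measurable N).
Context (PC : P `<=` centered C) (NC : N `<=` centered C).
Context (P_ge : forall z, P z -> b <= z) (N_le : forall z, N z -> z <= - b).
Context (P_near : forall e : R, 0 < e -> (0 < mu (P `&` centered (b + e)))%E).
Context (N_near : forall e : R, 0 < e -> (0 < mu (N `&` centered (b + e)))%E).

Lemma massP_gt0 t x : t <= 0 -> 0 < mass mu P t x.
Proof.
apply: (mass_gt0 mu C P (b + 1)) => //; last exact: P_near.
by rewrite addr_ge0 // ltW.
Qed.

Lemma massN_gt0 t x : t <= 0 -> 0 < mass mu N t x.
Proof.
apply: (mass_gt0 mu C N (b + 1)) => //; last exact: N_near.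
by rewrite addr_ge0 // ltW.
Qed.

Lemma P_right h z : 0 <= h -> P z -> b * `|h| <= z * h.
Proof. by move=> h0 /P_ge bz; rewrite ger0_norm // ler_wpM2r. Qed.

Lemma N_right h z : 0 <= h -> N z -> b * `|h| <= z * - h.
Proof.
by move=> h0 /N_le zb; rewrite ger0_norm // mulrN -mulNr ler_wpM2r // lerNr.
Qed.

Lemma P_left h z : h <= 0 -> P z -> b * `|h| <= z * - h.
Proof. by rewrite -oppr_ge0 -normrN => h0; exact: P_right. Qed.

Lemma N_left h z : h <= 0 -> N z -> b * `|h| <= z * h.
Proof.
rewrite -oppr_ge0 -normrN => h0 Nz.
by have := N_right _ _ h0 Nz; rewrite opprK.
Qed.

(** The ratio of the two masses decreases at least like exp (- b x), so that it
    passes 1 within an explicit distance of the origin. *)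
Lemma balance t : t <= 0 -> exists s, mass mu P t s = mass mu N t s.
Proof.
move=> t0; have p0 x := massP_gt0 t x t0; have n0 x := massN_gt0 t x t0.
set G := fun x => mass mu P t x - mass mu N t x.
have cG : continuous G.
  by move=> x; apply: cvgB; exact: (continuous_mass mu C).
have cross p n E h : 0 < p -> 0 < n -> h = p / n / b -> E = expR (- (b * h)) ->
    E * p <= n.
  move=> p_gt0 n_gt0 -> ->; rewrite expRN ler_pdivrMl ?expR_gt0 //.
  rewrite mulrCA mulfV ?gt_eqF // mulr1.
  apply: le_trans (_ : (1 + p / n) * n <= _); last first.
    by rewrite ler_pM2r // expR_ge1Dx.
  by rewrite mulrDl divfK ?gt_eqF // lerDr mul1r ltW.
(* At distance r / b the ratio r of the masses at the origin has been divided by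
   at least exp r >= 1 + r. *)
set hr := mass mu P t 0 / mass mu N t 0 / b.
set hl := mass mu N t 0 / mass mu P t 0 / b.
have hr0 : 0 <= hr by rewrite !divr_ge0 // ltW.
have hl0 : 0 <= hl by rewrite !divr_ge0 // ltW.
have Gr : G hr <= 0.
  have := ratio_upper P N t 0 hr mP mN PC NC (fun z => P_right _ z hr0)
    (fun z => N_right _ z hr0).
  rewrite add0r ger0_norm // mulrA => up.
  have := cross _ _ _ _ (p0 0) (n0 0) erefl erefl => /(ler_wpM2r (ltW (n0 hr))).
  move/(le_trans up); rewrite [X in _ <= X]mulrC ler_pM2r // => ?.
  by rewrite subr_le0.
have Gl : 0 <= G (- hl).
  have hl0' : - hl <= 0 by rewrite oppr_le0.
  have := ratio_upper N P t 0 (- hl) mN mP NC PC (fun z => N_left _ z hl0')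
    (fun z => P_left _ z hl0').
  rewrite add0r normrN ger0_norm // mulrA => up.
  have := cross _ _ _ _ (n0 0) (p0 0) erefl erefl.
  move=> /(ler_wpM2r (ltW (p0 (- hl)))).
  move/(le_trans up); rewrite [X in _ <= X]mulrC ler_pM2r // => ?.
  by rewrite subr_ge0.
have [|||s _ Gs] := @IVT _ G (- hl) hr 0.
- by rewrite (le_trans _ hr0) // oppr_le0.
- exact: continuous_subspaceT.
- by rewrite ge_min Gr orbT le_max Gl.
by exists s; apply/eqP; rewrite -subr_eq0; apply/eqP.
Qed.

(** Moving from the origin to the balance point changes the ratio of the masses
    by a factor at least exp (b |s t|), and this factor cannot exceed the ratio
    of the masses at the origin, which is exp (o(t)). *)
Lemma balance_sublinear (s : R -> R) :
  (forall t, t <= 0 -> mass mu P t (s t) = mass mu N t (s t)) ->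
  s t / t @[t --> -oo] --> (0 : R).
Proof.
move=> bal; apply/cvgrPdist_le => eps eps_gt0.
have eb : 0 < eps * b by rewrite mulr_gt0.
have loP := laplace_lower P b _ mP PC (ltW b_gt0) eb P_near.
have loN := laplace_lower N b _ mN NC (ltW b_gt0) eb N_near.
near=> t; have t_lt0 : t < 0 by near: t; exact: nbhs_ninfty_lt.
have loPt : expR (b ^+ 2 * t / 4 + eps * b * t) <= mass mu P t 0 by near: t.
have loNt : expR (b ^+ 2 * t / 4 + eps * b * t) <= mass mu N t 0 by near: t.
have t0 := ltW t_lt0.
have p0 x := massP_gt0 t x t0; have n0 x := massN_gt0 t x t0.
(* A is the side of the support whose mass decreases from 0 to s t. *)
have bound A B : measurable A -> A `<=` centered C ->
    (forall z, A z -> b <= `|z|) -> 0 < mass mu A t (s t) ->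
    mass mu A t (s t) = mass mu B t (s t) ->
    mass mu A t (s t) * mass mu B t 0 <=
      expR (- (b * `|s t|)) * (mass mu A t 0 * mass mu B t (s t)) ->
    expR (b ^+ 2 * t / 4 + eps * b * t) <= mass mu B t 0 ->
    `|s t| <= eps * - t.
  move=> mA AC Ab A_gt0 AB up lo.
  have upA := mass_le mu C A b t 0 mA t0 (ltW b_gt0) C_ge0 Ab AC.
  rewrite normr0 mulr0 mul0r add0r in upA.
  rewrite -AB [X in _ <= _ * X]mulrC mulrCA ler_pM2l // in up.
  have := le_trans (le_trans lo up) (ler_wpM2l (expR_ge0 _) upA).
  rewrite -expRD ler_expR => le; rewrite -(ler_pM2l b_gt0); lra.
rewrite sub0r normrN normrM normfV (ltr0_norm t_lt0) ler_pdivrMr ?oppr_gt0 //.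
have [s0|s0] := leP 0 (s t).
  apply: (bound P N) => //; last 2 first.
  - exact: bal.
  - have := ratio_upper P N t 0 (s t) mP mN PC NC (fun z => P_right _ z s0)
      (fun z => N_right _ z s0).
    by rewrite add0r.
  by move=> z /P_ge bz; rewrite (le_trans bz) // ler_norm.
have s0' := ltW s0.
apply: (bound N P) => //; last 2 first.
- by rewrite bal.
- have := ratio_upper N P t 0 (s t) mN mP NC PC (fun z => N_left _ z s0')
      (fun z => P_left _ z s0').
  by rewrite add0r.
by move=> z /N_le zb; rewrite -normrN (le_trans _ (ler_norm _)) // lerNr.
Unshelve. all: by end_near. Qed.

End two_sided.

(** * The edges of the support next to the origin *)

Section support_edges.
Context {R : realType} (mu : probability (measurableTypeR R) R).

Lemma supp_neq0 : supp mu !=set0.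
Proof.
apply/set0P/negP => /eqP S0.
have := measure_not_supp mu; rewrite S0 setC0 probability_setT => /eqP.
by rewrite onee_eq0.
Qed.

Lemma measure_gt0 (D : set (measurableTypeR R)) (U : set R) (c : R) :
  measurable D -> open U -> supp mu c -> U c -> supp mu `&` U `<=` D ->
  (0 < mu D)%E.
Proof.
move=> mD oU Sc Uc UD; have mU : measurable (U : set (measurableTypeR R)).
  exact: open_measurable.
apply: (@lt_le_trans _ _ (mu U)); first exact: Sc.
rewrite -(measure_suppI mu U mU); apply: le_measure => //; rewrite inE //.
by apply: measurableI => //; exact: measurable_supp.
Qed.

Lemma supp_pos_inf_le c : supp mu c -> 0 < c -> (supp_pos_inf mu <= c%:E)%E.
Proof. by move=> Sc c0; apply: ereal_inf_lbound; exists c. Qed.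

Lemma supp_neg_sup_ge c : supp mu c -> c < 0 -> (c%:E <= supp_neg_sup mu)%E.
Proof. by move=> Sc c0; apply: ereal_sup_ubound; exists c. Qed.

Lemma supp_pos_inf_ge0 : (0 <= supp_pos_inf mu)%E.
Proof.
by apply: le_ereal_inf_tmp => _ [c [c0 _] <-]; rewrite lee_fin ltW.
Qed.

Lemma supp_neg_sup_le0 : (supp_neg_sup mu <= 0)%E.
Proof.
by apply: ge_ereal_sup => _ [c [c0 _] <-]; rewrite lee_fin ltW.
Qed.

Lemma supp_pos_inf_adherent (b e : R) : supp_pos_inf mu = b%:E -> 0 < e ->
  exists c, [/\ supp mu c, 0 < c & c < b + e].
Proof.
move=> bE e0; have bfin : supp_pos_inf mu \is a fin_num by rewrite bE.
have [_ [c [c0 Sc] <-]] := lb_ereal_inf_adherent e0 bfin.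
by rewrite -/(supp_pos_inf mu) bE -EFinD lte_fin; exists c.
Qed.

Lemma supp_neg_sup_adherent (a e : R) : supp_neg_sup mu = a%:E -> 0 < e ->
  exists c, [/\ supp mu c, c < 0 & a - e < c].
Proof.
move=> aE e0; have afin : supp_neg_sup mu \is a fin_num by rewrite aE.
have [_ [c [c0 Sc] <-]] := ub_ereal_sup_adherent e0 afin.
by rewrite -/(supp_neg_sup mu) aE -EFinB lte_fin; exists c.
Qed.

Lemma measure_near_pos (D : set (measurableTypeR R)) (b e : R) :
  measurable D -> supp_pos_inf mu = b%:E -> 0 < e ->
  (forall z, supp mu z -> 0 < z -> D z) ->
  (0 < mu (D `&` centered (b + e)))%E.
Proof.
move=> mD bE e0 SD; have [c [Sc c0 ce]] := supp_pos_inf_adherent _ _ bE e0.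
apply: (measure_gt0 _ `]0, b + e[%classic c) => //.
- by apply: measurableI => //; exact: measurable_centered.
- by rewrite /= in_itv /= c0.
move=> z [Sz /=]; rewrite in_itv /= => /andP[z0 ze]; split; first exact: SD.
by rewrite /centered /= gtr0_norm // ltW.
Qed.

Lemma measure_near_neg (D : set (measurableTypeR R)) (a e : R) :
  measurable D -> supp_neg_sup mu = a%:E -> 0 < e ->
  (forall z, supp mu z -> z < 0 -> D z) ->
  (0 < mu (D `&` centered (- a + e)))%E.
Proof.
move=> mD aE e0 SD; have [c [Sc c0 ce]] := supp_neg_sup_adherent _ _ aE e0.
apply: (measure_gt0 _ `]a - e, 0[%classic c) => //.
- by apply: measurableI => //; exact: measurable_centered.
- by rewrite /= in_itv /= c0 andbT.
move=> z [Sz /=]; rewrite in_itv /= => /andP[ze z0]; split; first exact: SD.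
by rewrite /centered /= ltr0_norm //; lra.
Qed.

(** A null infimum would make 0 a limit of points of the support, which is
    closed. *)
Lemma supp_pos_inf_gt0 : ~ supp mu 0 -> (0 < supp_pos_inf mu)%E.
Proof.
move=> S0; rewrite lt_neqAle supp_pos_inf_ge0 andbT; apply/eqP => b0; apply: S0.
move=> U [oU U0]; have : nbhs (0 : R) U by rewrite nbhsE; exists U.
rewrite -nbhs_ballE => -[e /= e0 eU].
have [c [Sc c0 ce]] := supp_pos_inf_adherent _ _ (esym b0) e0.
apply: Sc; split => //; apply: eU.
by rewrite /ball /= sub0r normrN gtr0_norm // -[e]add0r.
Qed.

Lemma supp_sign : ~ supp mu 0 -> forall z, supp mu z -> z < 0 \/ 0 < z.
Proof. by move=> S0 z Sz; case: (ltrgt0P z) Sz => [||->]; [right|left|]. Qed.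

(** The assumption says that the negative part of the support is farther from
    the origin than b; half of the margin, when it is finite, is the eta of
    [bottom_point]. *)
Lemma bottom_point_pos (b : R) : ~ supp mu 0 -> supp_pos_inf mu = b%:E ->
  (supp_neg_sup mu < (- b)%:E)%E -> bottom_point mu (supp mu) b.
Proof.
move=> S0 bE ab; have b0 : 0 <= b by rewrite -lee_fin -bE supp_pos_inf_ge0.
rewrite /bottom_point ger0_norm //; split=> [e e0|].
  by apply: measure_near_pos => //; exact: measurable_supp.
have [eta eta0 aeta] : exists2 eta, 0 < eta &
    (supp_neg_sup mu < (- b - eta)%:E)%E.
  case aE : (supp_neg_sup mu) ab => [a| |] //; last first.
    by exists 1 => //; rewrite ltNyr.
  rewrite lte_fin => ab; exists ((- b - a) / 2); first lra.
  by rewrite lte_fin; lra.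
exists eta => // z Sz zb; have [z0|z0] := supp_sign S0 z Sz.
  have := le_lt_trans (supp_neg_sup_ge z Sz z0) aeta; rewrite lte_fin.
  by move: zb; rewrite ltr0_norm //; lra.
have := supp_pos_inf_le z Sz z0; rewrite bE lee_fin => bz.
by rewrite (gtr0_norm z0) ger0_norm // subr_ge0.
Qed.

Lemma bottom_point_neg (a : R) : ~ supp mu 0 -> supp_neg_sup mu = a%:E ->
  ((- a)%:E < supp_pos_inf mu)%E -> bottom_point mu (supp mu) a.
Proof.
move=> S0 aE ab; have a0 : a <= 0 by rewrite -lee_fin -aE supp_neg_sup_le0.
rewrite /bottom_point ler0_norm //; split=> [e e0|].
  by apply: measure_near_neg => //; exact: measurable_supp.
have [eta eta0 beta] : exists2 eta, 0 < eta &
    ((- a + eta)%:E < supp_pos_inf mu)%E.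
  case bE : (supp_pos_inf mu) ab => [b| |] //; last first.
    by exists 1 => //; rewrite ltry.
  rewrite lte_fin => ab; exists ((b + a) / 2); first lra.
  by rewrite lte_fin; lra.
exists eta => // z Sz zb; have [z0|z0] := supp_sign S0 z Sz; last first.
  have := lt_le_trans beta (supp_pos_inf_le z Sz z0); rewrite lte_fin.
  by move: zb; rewrite gtr0_norm //; lra.
have := supp_neg_sup_ge z Sz z0; rewrite aE lee_fin => za.
by rewrite (ltr0_norm z0) ler0_norm ?subr_le0 // opprB; lra.
Qed.

(** With the convention -oo + +oo = -oo, this degenerate case would count as a
    negative sum of the edges, with no finite edge to converge to. *)
Lemma edges_not_both_infinite : ~ supp mu 0 ->
  ~ (supp_neg_sup mu = -oo%E /\ supp_pos_inf mu = +oo%E).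
Proof.
move=> S0 [aE bE]; have [z Sz] := supp_neq0.
have [z0|z0] := supp_sign S0 z Sz.
- by have := supp_neg_sup_ge z Sz z0; rewrite aE leeNy_eq.
- by have := supp_pos_inf_le z Sz z0; rewrite bE leye_eq.
Qed.

End support_edges.

(** * Asymptotics of the solution *)

Section burgers.
Context {R : realType} (mu : probability (measurableTypeR R) R) (C : R).
Context (C_ge0 : 0 <= C) (SC : supp mu `<=` centered C).

Lemma Rintegral_supp (f : R -> R) : continuous f ->
  \int[mu]_(z in [set: R]) f z = \int[mu]_(z in supp mu) f z.
Proof.
move=> cf; have mS := measurable_supp mu; have mSc := measurableC mS.
rewrite /Rintegral (negligible_integral mSc) //; first by rewrite setTD setCK.
  apply/(negligible_integrable mSc measurableT).
  - by apply/measurable_EFinP; exact: continuous_measurable_fun.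
  - exact: measure_not_supp.
  rewrite setTD setCK; exact: (integrable_continuous mu C).
exact: measure_not_supp.
Qed.

Lemma burgers_entireE t x : burgers_entire mu t x =
  (\int[mu]_(z in supp mu) (z * weight t x z)) / mass mu (supp mu) t x.
Proof.
rewrite /burgers_entire /mass -!Rintegral_supp //.
- by move=> z; exact: continuous_weight.
- by move=> z; apply: cvgM; [exact: cvg_id|exact: continuous_weight].
Qed.

Lemma burgers_cvg_bottom d eps : bottom_point mu (supp mu) d -> 0 < eps ->
  near_cone (fun t x => `|burgers_entire mu t x - d| <= eps).
Proof.
move=> Sd eps_gt0; have mS := measurable_supp mu.
apply: near_coneS (first_moment mu C _ _ _ mS SC C_ge0 Sd eps_gt0).
near=> t; have t0 : t <= 0 by near: t; exact: nbhs_ninfty_le.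
move=> x; have m_gt0 : 0 < mass mu (supp mu) t x.
  apply: (mass_gt0 mu C _ (`|d| + 1)) => //.
  by case: Sd => + _; exact.
rewrite burgers_entireE.
set m := mass _ _ _ _ in m_gt0 *; set I := Rintegral _ _ _.
move=> le; have -> : I / m - d = (I - d * m) / m by field; rewrite gt_eqF.
by rewrite normrM normfV (gtr0_norm m_gt0) ler_pdivrMr.
Unshelve. all: by end_near. Qed.

Lemma bottom_point_halfline (D : set (measurableTypeR R)) (d : R) :
  (forall e : R, 0 < e -> (0 < mu (D `&` centered (`|d| + e)))%E) ->
  (forall z, D z -> `|z - d| = `|z| - `|d|) -> bottom_point mu D d.
Proof. by move=> Dnear Dd; split=> //; exists 1 => // z Dz _; exact: Dd. Qed.

(** With P and N the positive and negative parts of the support, [first_moment]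
    applied to each of them replaces u by b (p - n) / (p + n), and
    [balanced_profile] compares the latter with the shock centred at the balance
    point. *)
Lemma burgers_cvg_shock (b : R) : ~ supp mu 0 -> 0 < b ->
  supp_pos_inf mu = b%:E -> supp_neg_sup mu = (- b)%:E ->
  exists s : R -> R, s t / t @[t --> -oo] --> (0 : R) /\
    forall eps, 0 < eps -> near_cone (fun t x =>
      `|burgers_entire mu t x - viscous_shock b (x - s t)| <= eps).
Proof.
move=> S0 b_gt0 bE aE; have mS := measurable_supp mu; have b_ge0 := ltW b_gt0.
set P : set (measurableTypeR R) := supp mu `&` [set` `]0, +oo[].
set N : set (measurableTypeR R) := supp mu `\` [set` `]0, +oo[].
have mI : measurable ([set` `]0, +oo[] : set (measurableTypeR R)).
  exact: measurable_itv.
have mP : measurable P by exact: measurableI.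
have mN : measurable N by exact: measurableD.
have PC : P `<=` centered C by move=> z [/SC].
have NC : N `<=` centered C by move=> z [/SC].
have P_ge z : P z -> b <= z.
  move=> [Sz /=]; rewrite in_itv /= andbT => z0.
  by rewrite -lee_fin -bE; exact: supp_pos_inf_le.
have N_le z : N z -> z <= - b.
  move=> [Sz /=]; rewrite in_itv /= andbT => /negP; rewrite -leNgt => z0.
  have {}z0 : z < 0 by case: (supp_sign mu S0 z Sz) => //; rewrite ltNge z0.
  by rewrite -lee_fin -aE; exact: supp_neg_sup_ge.
have P_near e : 0 < e -> (0 < mu (P `&` centered (b + e)))%E.
  move=> e0; apply: measure_near_pos => // z Sz z0.
  by split => //=; rewrite in_itv /= andbT.
have N_near e : 0 < e -> (0 < mu (N `&` centered (b + e)))%E.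
  move=> e0; rewrite -[b]opprK; apply: measure_near_neg => // z Sz z0.
  by split => //=; rewrite in_itv /= andbT; apply/negP; rewrite -leNgt ltW.
have P_bottom : bottom_point mu P b.
  apply: bottom_point_halfline; rewrite ger0_norm // => z /P_ge bz.
  by rewrite !ger0_norm ?subr_ge0 // (le_trans b_ge0).
have N_bottom : bottom_point mu N (- b).
  apply: bottom_point_halfline; rewrite normrN ger0_norm // => z /N_le zb.
  have z0 : z <= 0 by lra.
  by rewrite !ler0_norm //; lra.
have split t x (f : R -> R) : continuous f ->
    \int[mu]_(z in supp mu) (f z * weight t x z) =
    \int[mu]_(z in P) (f z * weight t x z) +
    \int[mu]_(z in N) (f z * weight t x z).
  move=> cf; rewrite -[in LHS](setUIDK (supp mu) [set` `]0, +oo[]).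
  rewrite Rintegral_setU //.
    by rewrite setUIDK; exact: (integrable_mul_weight mu C).
  by apply/disj_setPS => z [[_ Az] [_]].
have bal0 t : exists s, t <= 0 -> mass mu P t s = mass mu N t s.
  have [t0|t0] := leP t 0; last by exists 0.
  have [s] := balance mu C b b_gt0 P N mP mN PC NC P_ge N_le P_near N_near t t0.
  by exists s.
have [s bal] := choice bal0; exists s.
have s_sub := balance_sublinear mu C b C_ge0 b_gt0 P N mP mN PC NC P_ge N_le
  P_near N_near s bal.
split=> // eps eps_gt0.
(* Concentration is needed both at x and at the balance point; the latter is
   covered because s is itself sublinear. *)
have s_abs : sublinear_at_Ny (fun t => `|s t|).
  split=> //; have := cvg_norm s_sub; rewrite normr0.
  under eq_fun do rewrite normrM normfV. exact.
set eta := eps / 8; have eta_gt0 : 0 < eta by rewrite divr_gt0.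
set e1 := Num.min 1 (eps / (16 * b)).
have e1_gt0 : 0 < e1 by rewrite lt_min ltr01 divr_gt0 // mulr_gt0.
have e1_le1 : e1 <= 1 by rewrite ge_min lexx.
have e1_le : e1 * (16 * b) <= eps.
  by rewrite -ler_pdivlMr ?mulr_gt0 // ge_min lexx orbT.
have eps2 : 0 < eps / 2 by rewrite divr_gt0.
have far := near_coneI _ _
  (concentration mu C P b eta e1 mP PC C_ge0 b_ge0 eta_gt0 e1_gt0 P_near)
  (concentration mu C N b eta e1 mN NC C_ge0 b_ge0 eta_gt0 e1_gt0 N_near).
have far_s := near_cone_sublinear _ _ s_abs far.
have moments := near_coneI _ _
  (first_moment mu C P b _ mP PC C_ge0 P_bottom eps2)
  (first_moment mu C N (- b) _ mN NC C_ge0 N_bottom eps2).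
apply: near_coneS (near_coneI _ _ far moments).
near=> t; have t0 : t <= 0 by near: t; exact: nbhs_ninfty_le.
have far_st : forall x, `|x| <= `|s t| ->
    mass mu (P `\` centered (b + eta)) t x <= e1 * mass mu P t x /\
    mass mu (N `\` centered (b + eta)) t x <= e1 * mass mu N t x by near: t.
have [farPs farNs] := far_st _ (lexx _).
move=> x [[farPx farNx] [momP momN]].
have b1 : 0 <= b + 1 by rewrite addr_ge0.
have p0 y : 0 < mass mu P t y.
  exact: (mass_gt0 mu C P _ t y mP PC b1 (P_near _ ltr01) t0).
have n0 y : 0 < mass mu N t y.
  exact: (mass_gt0 mu C N _ t y mN NC b1 (N_near _ ltr01) t0).
rewrite burgers_entireE (split t x id); last by move=> z; exact: cvg_id.
have -> : mass mu (supp mu) t x = mass mu P t x + mass mu N t x.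
  exact: (mass_split mu C).
set p := mass mu P t x in momP *; set n := mass mu N t x in momN *.
set Ip := Rintegral _ P _ in momP *; set In := Rintegral _ N _ in momN *.
have pn0 : 0 < p + n by rewrite addr_gt0 // ?p0 ?n0.
have u_near : `|(Ip + In) / (p + n) - b * ((p - n) / (p + n))| <= eps / 2.
  have -> : (Ip + In) / (p + n) - b * ((p - n) / (p + n)) =
      ((Ip - b * p) + (In - (- b) * n)) / (p + n) by field; rewrite gt_eqF.
  rewrite normrM normfV (gtr0_norm pn0) ler_pdivrMr //.
  by rewrite (le_trans (ler_normD _ _)) // mulrDr lerD.
have shock_near : `|b * ((p - n) / (p + n)) - viscous_shock b (x - s t)| <=
    b * (4 * e1 + 2 * eta / b).
  have sx : s t + (x - s t) = x by rewrite addrC subrK.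
  have [h0|h0] := leP 0 (x - s t).
    have := balanced_profile mu C b b_gt0 P N e1 eta t (s t) (x - s t) mP mN
      PC NC (fun z => P_right b P P_ge _ z h0)
      (fun z => N_right b N N_le _ z h0) p0 n0
      (bal t t0) (ltW eta_gt0) (ltW e1_gt0) e1_le1 farPs.
    by rewrite sx (ger0_norm h0); apply.
  have h0' := ltW h0.
  have := balanced_profile mu C b b_gt0 N P e1 eta t (s t) (x - s t) mN mP NC PC
      (fun z => N_left b N N_le _ z h0') (fun z => P_left b P P_ge _ z h0')
      n0 p0 (esym (bal t t0)) (ltW eta_gt0) (ltW e1_gt0) e1_le1 farNs.
  rewrite sx (ler0_norm h0') viscous_shockN opprK -normrN => /(_ farPx).
  by rewrite opprD -mulrN -mulNr opprB [n + p]addrC.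
have err : b * (4 * e1 + 2 * eta / b) <= eps / 2.
  have -> : b * (4 * e1 + 2 * eta / b) = 4 * (b * e1) + 2 * eta.
    by field; rewrite gt_eqF.
  by rewrite /eta; lra.
(* eps / 2 comes from the first moments and eps / 2 from the profile. *)
rewrite -[X in X - _](subrK (b * ((p - n) / (p + n)))) -addrA.
apply: (le_trans (ler_normD _ _)); lra.
Unshelve. all: by end_near. Qed.

End burgers.

Theorem proposition5p8 (R : realType)
    (mu : probability (measurableTypeR R) R)
    (hbnd : exists m M : R, supp mu `<=` `[m, M])
    (h0 : ~ supp mu 0) :
  let u := burgers_entire mu in
  let a : \bar R := supp_neg_sup mu in
  let b : \bar R := supp_pos_inf mu in
  ((a + b)%E <> 0%E ->
    let d : R := if (a + b < 0)%E then fine b else fine a in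
    forall L : R -> R, sublinear_at_Ny L ->
      sup_dist (L t) (u t) (fun=> d) @[t --> -oo] --> (0%E : \bar R))
  /\
  ((a + b)%E = 0%E ->
    exists s : R -> R,
      s t / t @[t --> -oo] --> (0 : R) /\
      forall L : R -> R, sublinear_at_Ny L ->
        sup_dist (L t) (u t) (fun x => viscous_shock (fine b) (x - s t))
          @[t --> -oo] --> (0%E : \bar R)).
Proof.
move=> u a b; have [m [M mM]] := hbnd.
set C := `|m| + `|M|; have C0 : 0 <= C by rewrite addr_ge0.
have SC : supp mu `<=` centered C.
  move=> z /mM /=; rewrite in_itv /= => /andP[mz zM].
  rewrite /centered /= ler_norml; apply/andP; split.
    by have := ler_norm (- m); rewrite normrN /C; have := normr_ge0 M; lra.
  by have := ler_norm M; rewrite /C; have := normr_ge0 m; lra.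
have a0 : (a <= 0)%E := supp_neg_sup_le0 mu.
have b0 : (0 < b)%E := supp_pos_inf_gt0 mu h0.
have ab_inf := edges_not_both_infinite mu h0.
split=> [ab0 d L HL|ab0].
  apply: sup_dist_cvg0 => // eps eps_gt0.
  apply: (burgers_cvg_bottom mu C) => //; rewrite /d.
  case: ifPn => [ab|]; last rewrite -leNgt => ab.
  - case bE : b b0 ab => [r| |] // _ ab; last first.
      case aE : a a0 ab => [r| |] // _ _.
      by case: ab_inf.
    apply: bottom_point_pos => //.
    case aE : a a0 ab => [r'| |] // _ ab; last by rewrite -/a aE ltNyr.
    by rewrite -/a aE; move: ab; rewrite -EFinD !lte_fin /=; lra.
  - have {}ab : (0 < a + b)%E by rewrite lt_neqAle ab andbT eq_sym; exact/eqP.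
    case aE : a a0 ab => [r| |] // _ ab.
    apply: bottom_point_neg => //.
    case bE : b b0 ab => [r'| |] // _ ab; last by rewrite -/b bE ltry.
    by rewrite -/b bE; move: ab; rewrite -EFinD !lte_fin /=; lra.
case bE : b b0 ab0 => [r| |] // b0 ab0; last first.
  by case aE : a a0 ab0 => [r| |].
have aE : a = (- r)%:E.
  case aE : a a0 ab0 => [r'| |] // _; rewrite -EFinD => -[] /eqP.
  by rewrite addr_eq0 => /eqP ->.
have [s [s_sub Hs]] := burgers_cvg_shock mu C C0 SC r h0 b0 bE aE.
exists s; split => // L HL.
by apply: sup_dist_cvg0 => // eps; exact: Hs.
Qed.
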